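(* For every integer $n\geqslant 2$, \[ \chi_{_{=}}(K_n\times K_{n,n-1})=\chi_{_{=}}^*(K_n\times K_{n,n-1})=n. \]
   Context: All graphs are finite, loopless, and without multiple edges. $K_n$ denotes the complete graph on $n$ vertices, and $K_{x,y}$ the complete bipartite graph with parts of sizes $x$ and $y$. The cross (direct) product $G_1\times G_2$ of $G_1=(V_1,E_1)$ and $G_2=(V_2,E_2)$ has vertex set $V_1\times V_2$, and $\{(u,x),(v,y)\}$ is an edge if and only if $uv\in E_1$ and $xy\in E_2$. A proper $k$-coloring of $G$ is a function $c:V(G)\to\{0,1,\ldots,k-1\}$ mapping adjacent vertices to distinct numbers; its color classes are $V_i=c^{-1}(i)$, $0\leqslant i\leqslant k-1$. $G$ is equitably $k$-colorable if it has a proper $k$-coloring whose color classes satisfy $\big||V_i|-|V_j|\big|\leqslant 1$ for all $i,j\in\{0,\ldots,k-1\}$. The equitable chromatic number $\chi_{_{=}}(G)$ is the smallest integer $r$ such that $G$ is equitably $r$-colorable. The equitable chromatic threshold $\chi_{_{=}}^*(G)$ is the smallest integer $r$ such that $G$ is equitably $k$-colorable for all $k\geqslant r$. *)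

(* Defs.v *)
(* MathComp world. *)
From mathcomp Require Import all_boot all_order all_algebra.

Set Implicit Arguments.
Unset Strict Implicit.
Unset Printing Implicit Defensive.

Record sgraph := SGraph {
  vertex :> finType;
  adj : rel vertex;
  adj_sym : symmetric adj;
  adj_irrefl : irreflexive adj
}.

Section Complete.
Variable n : nat.

Definition complete_adj : rel 'I_n := fun u v => u != v.

Lemma complete_adj_sym : symmetric complete_adj.
Proof. by move=> u v; rewrite /complete_adj eq_sym. Qed.

Lemma complete_adj_irrefl : irreflexive complete_adj.
Proof. by move=> u; rewrite /complete_adj eqxx. Qed.

Definition complete_graph : sgraph :=
  SGraph complete_adj_sym complete_adj_irrefl.

End Complete.

Section CompleteBipartite.
Variables x y : nat.

Definition bipartite_adj : rel ('I_x + 'I_y)%type := fun u v =>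
  match u, v with
  | inl _, inr _ | inr _, inl _ => true
  | _, _ => false
  end.

Lemma bipartite_adj_sym : symmetric bipartite_adj.
Proof. by move=> [u|u] [v|v]. Qed.

Lemma bipartite_adj_irrefl : irreflexive bipartite_adj.
Proof. by case. Qed.

Definition complete_bipartite : sgraph :=
  SGraph bipartite_adj_sym bipartite_adj_irrefl.

End CompleteBipartite.

Section CrossProduct.
Variables G1 G2 : sgraph.

Definition cross_adj : rel (G1 * G2)%type := fun p q =>
  adj p.1 q.1 && adj p.2 q.2.

Lemma cross_adj_sym : symmetric cross_adj.
Proof.
by move=> p q; rewrite /cross_adj (adj_sym p.1) (adj_sym p.2).
Qed.

Lemma cross_adj_irrefl : irreflexive cross_adj.
Proof. by move=> p; rewrite /cross_adj adj_irrefl. Qed.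

Definition cross_product : sgraph := SGraph cross_adj_sym cross_adj_irrefl.

End CrossProduct.

Definition proper_coloring (G : sgraph) (k : nat) (c : G -> 'I_k) : Prop :=
  forall u v : G, adj u v -> c u <> c v.

Definition color_class (G : sgraph) (k : nat) (c : G -> 'I_k) (i : 'I_k) :
  {set G} := [set v | c v == i].

(* [`|a - b|%N] is the absolute difference of naturals computed in [int],
   not truncated subtraction. *)
Definition equitably_colorable (G : sgraph) (k : nat) : Prop :=
  exists c : G -> 'I_k, proper_coloring c /\
    forall i j : 'I_k,
      (`|#|color_class c i| - #|color_class c j| | <= 1)%N.

Definition is_smallest (P : nat -> Prop) (r : nat) : Prop :=
  P r /\ forall m : nat, P m -> r <= m.

Definition equitable_chromatic_number (G : sgraph) (r : nat) : Prop :=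
  is_smallest (equitably_colorable G) r.

Definition equitable_chromatic_threshold (G : sgraph) (r : nat) : Prop :=
  is_smallest (fun s => forall k : nat, s <= k -> equitably_colorable G k) r.

(* Main.v *)
Require Import Defs.
From mathcomp Require Import all_boot all_order all_algebra zify.

(** Write X_u for the vertices (u, left) and Y_u for the vertices (u, right).
    Vertices are adjacent exactly when they lie on opposite sides and over
    different u, so an independent set lies inside one side or inside one fibre
    X_u + Y_u.  Call a color class mixed if it meets both sides: it then has at
    most x + y vertices in K_n x K_{x,y}, and 2n - 1 in the graph of the theorem.

    Fewer than n colors are impossible: the classes of an equitable coloring
    would all have more than 2n - 1 vertices, so none would be mixed.  The two
    sides would then be cut separately into a and b classes of sizes q or q + 1,
    with a + b < n ([unmixed_counts]).  The side sizes n^2 and n(n - 1) do not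
    allow this ([no_unmixed_split]): averaging over the classes, n^2 / a and
    n(n - 1) / b would differ by at most 1.

    Every number k >= n of colors is possible.  Reserve sx vertices of the left
    side and sy of the right side for m <= n mixed classes, one in each of m
    fibres, and cut what remains of the sides into a and b classes.  As the
    remainders of the sides are independent, they can be cut freely, and the
    reserved vertices can be spread evenly over the m fibres; hence only
    numerical conditions on q, a, b, m, sx, sy have to be met
    ([mixed_coloring]).  For k = n + t <= 2n - 1, n - t mixed classes and t
    classes on each side work: the t pure classes of a side replace t fibres,
    and they absorb them since q >= n ([colorable_few_colors]).  For
    k >= 2n - 1, classes have at most n vertices, and one mixed class suffices:
    list the left side and then the right side, cut the list into intervals,
    and let the mixed class be the interval that reaches the end of the left
    side ([colorable_many_colors]). *)

Set Implicit Arguments.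
Unset Strict Implicit.
Unset Printing Implicit Defensive.

(** * Arithmetic *)

(** Raising [s] by one shifts the window of numerators by one, which replaces
    [s %/ m] by [(s + m) %/ m]. *)
Lemma sum_divnD m s : 0 < m -> \sum_(u < m) (s + u) %/ m = s.
Proof.
move=> m0; elim: s => [|s IHs].
  by rewrite big1 // => u _; rewrite add0n divn_small.
case: m m0 IHs => // m _ IHs.
rewrite big_ord_recr /= addSnnS divnDr ?dvdnn // divnn /= addn1 addnS.
rewrite -[in RHS]IHs big_ord_recl /= addn0 addnC; congr (_ + _).+1.
by apply: eq_bigr => i _; rewrite /bump /= add1n addSnnS.
Qed.

(** An equitable coloring with [n + t] colors has [r] large classes, of size
    [q.+1], the other ones having size [q].  So [t] classes fit in each side, even
    when those on the left are all large and the right receives the [r - n] large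
    classes in excess of the [n] other ones.  The second bound holds because the
    average size of the classes on the right then does not exceed the overall
    average, [(n + t) * (r - n) <= t * r]. *)
Lemma pure_classes_fit n t q r : 2 <= n -> t < n -> r < n + t ->
  n * (2 * n - 1) = q * (n + t) + r ->
  [/\ n <= q, t * q.+1 <= n * n & t * q + (r - n) <= n * (n - 1)].
Proof.
move=> n2 tn rk E.
have [d Ed]: exists d, n = t + d.+1 by exists (n - t.+1); lia.
have nq : n <= q by rewrite leqNgt; apply/negP => H; nia.
split=> //.
  have : (n+t) * (t * q.+1) <= (n+t) * (n * n) by nia.
  by rewrite leq_pmul2l; lia.
have H: (n+t) * (t * q + (r - n)) <= (n+t) * (n * (n - 1)).
 have : (n+t) * (t * q + (r - n)) <= t * (n * (2 * n - 1)).
   have : (n + t) * (r - n) <= t * r by case: (leqP r n) => ?; nia.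
   nia.
 move=> /leq_trans; apply. nia.
by move: H; rewrite leq_pmul2l; lia.
Qed.

(** Eliminating [q] leaves [n * n * b <= n * (n - 1) * a + a * b] and
    [n * (n - 1) * a <= n * n * b + a * b], with [a] and [b] positive as both
    sides are nonempty.  The first fails for [a <= b], where the gap
    [n * n * (b - a) + n * a] exceeds [a * b]; the second fails for [b < a], where
    the gap is at least [n * (n - a)] and [b < n - a]. *)
Lemma no_unmixed_split n a b q : 2 <= n -> a + b < n -> 
  a * q <= n * n <= a * q.+1 -> b * q <= n * (n - 1) <= b * q.+1 -> False.
Proof.
case: n => // n _ ab; rewrite subn1 /= => /andP [h1 h2] /andP [h3 h4].
case: (leqP a b) => h.
 have e1 : n.+1 * n.+1 * b <= a * b * q.+1 by nia.
 have e2 : a * b * q <= n.+1 * n * a by nia.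
 have e3 : n.+1 * n.+1 * b <= n.+1 * n * a + a * b by nia.
 have [d Ed]: exists d, b = a + d by exists (b - a); lia.
 subst b. nia.
have e1 : n.+1 * n * a <= a * b * q.+1 by nia.
have e2 : a * b * q <= n.+1 * n.+1 * b by nia.
have e3 : n.+1 * n * a <= n.+1 * n.+1 * b + a * b by nia.
have [d Ed]: exists d, a = b + d.+1 by exists (a - b.+1); lia.
have [f Ef]: exists f, n = a + b + f by exists (n - (a + b)); lia.
subst n a. nia.
Qed.

(** * Equitable colorings of blocks of vertices *)

(** Fixing the sizes [q] and [q.+1], rather than asking class sizes to be close,
    lets colorings of disjoint blocks be put together into an equitable one. *)
Definition block_colorable (G : sgraph) (S : {set G}) (k q : nat) : Prop :=
  exists c : G -> nat,
    [/\ {in S, forall v, c v < k},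
        {in S &, forall u v, adj u v -> c u <> c v} &
        forall i, i < k -> q <= #|[set v in S | c v == i]| <= q.+1].

Lemma block_colorable0 (G : sgraph) q : block_colorable (@set0 G) 0 q.
Proof. by exists (fun=> 0); split=> // v; rewrite inE. Qed.

Lemma block_colorableU (G : sgraph) (S T : {set G}) k l q :
  [disjoint S & T] -> block_colorable S k q -> block_colorable T l q ->
  block_colorable (S :|: T) (k + l) q.
Proof.
move=> dST [c [cS cI cn]] [d [dS dI dn]].
have nST v : v \in T -> v \in S = false.
  move=> vT; apply/negbTE; apply: contraL dST => vS.
  by apply/pred0Pn; exists v; apply/andP.
exists (fun v => if v \in S then c v else k + d v); split.
- move=> v; rewrite inE; case: ifP => [/cS cv _|_ /= /dS dv]; lia.
- move=> u v; rewrite !inE.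
  case: ifP => [uS _|_ /= uT]; case: ifP => [vS _|_ /= vT] uv //.
  + exact: cI uv.
  + by have := cS _ uS; lia.
  + by have := cS _ vS; lia.
  + by move/addnI; apply: dI uv.
move=> i ik; case: (ltnP i k) => ki.
  rewrite (_ : [set v in S :|: T | _] = [set v in S | c v == i]) ?cn //.
  apply/setP => v; rewrite !inE; case: ifP => //= _.
  by case: (v \in T) => //=; apply/negbTE/eqP; lia.
rewrite (_ : [set v in S :|: T | _] = [set v in T | d v == i - k]) ?dn //;
  first lia.
apply/setP => v; rewrite !inE; case: (boolP (v \in T)) => [/nST -> /=|_].
  by apply/eqP/eqP; lia.
by rewrite orbF; case: ifP => //= /cS cv; apply/negbTE/eqP; lia.
Qed.

Lemma block_colorable1 (G : sgraph) (S : {set G}) q :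
  {in S &, forall u v, ~~ adj u v} -> q <= #|S| <= q.+1 ->
  block_colorable S 1 q.
Proof.
move=> indS Sq; exists (fun=> 0); split=> // [u v uS vS|[|//] _].
  by move=> uv; have := indS _ _ uS vS; rewrite uv.
by rewrite (_ : [set v in S | _] = S) //; apply/setP => v; rewrite !inE andbT.
Qed.

Lemma exists_subset_card (T : finType) (S : {set T}) s :
  s <= #|S| -> exists2 A : {set T}, A \subset S & #|A| = s.
Proof.
move=> sS; exists [set x in take s (enum S)].
  by apply/subsetP => x; rewrite inE => /mem_take; rewrite mem_enum.
rewrite cardsE; have /card_uniqP -> := take_uniq s (enum_uniq S).
by rewrite size_takel -?cardE.
Qed.

(** With no edges inside [S], classes can be removed one by one; a class of size
    [maxn q (#|S| - k * q.+1)] is as small as the remaining [k] classes allow. *)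
Lemma block_colorable_independent (G : sgraph) (S : {set G}) k q :
  {in S &, forall u v, ~~ adj u v} -> k * q <= #|S| <= k * q.+1 ->
  block_colorable S k q.
Proof.
elim: k S => [|k IHk] S indS /andP [lo hi].
  have /cards0_eq -> : #|S| = 0 by lia.
  exact: block_colorable0.
have [|A AS Acard] := @exists_subset_card _ S (maxn q (#|S| - k * q.+1)).
  nia.
rewrite -(setID S A) (setIidPr AS) -add1n; apply: block_colorableU.
- by rewrite -setI_eq0 setDE setICA setICr setI0.
- apply: block_colorable1 => [u v uA vA|]; last by rewrite Acard; nia.
  by apply: indS; apply: (subsetP AS).
apply: IHk => [u v /setDP [uS _] /setDP [vS _]|]; first exact: indS.
by rewrite cardsD (setIidPr AS) Acard; nia.
Qed.

Lemma block_colorable_equitable (G : sgraph) k q :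
  block_colorable [set: G] k q -> equitably_colorable G k.
Proof.
move=> [c [ck cadj cn]]; exists (fun v => Ordinal (ck v (in_setT v))); split.
  by move=> u v uv [] /(cadj _ _ (in_setT u) (in_setT v) uv).
move=> i j; have ci (l : 'I_k) :
    q <= #|color_class (fun v => Ordinal (ck v (in_setT v))) l| <= q.+1.
  rewrite (_ : color_class _ l = [set v in [set: G] | c v == l]) ?cn //.
  by apply/setP => v; rewrite !inE -val_eqE.
by have := ci i; have := ci j; lia.
Qed.

Lemma card_ord_ltn m c : c <= m -> #|[set i : 'I_m | i < c]| = c.
Proof.
move=> cm; rewrite -sum1dep_card (big_ord_narrow cm).
by rewrite sum_nat_const card_ord muln1.
Qed.

(** * The cross product of a complete and a complete bipartite graph *)

Section CrossCompleteBipartite.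
Variables n x y : nat.
Local Notation G := (cross_product (complete_graph n) (complete_bipartite x y)).

Lemma card_cross (A : {set G}) :
  #|A| = \sum_(u < n) (#|[set i : 'I_x | (u, inl i) \in A]| +
                       #|[set j : 'I_y | (u, inr j) \in A]|).
Proof.
rewrite -sum1_card big_mkcond /=.
transitivity (\sum_(u < n) \sum_(w : 'I_x + 'I_y) if (u, w) \in A then 1 else 0).
  by rewrite pair_bigA; apply: eq_bigr => -[].
apply: eq_bigr => u _; rewrite big_sumType /= -!sum1_card.
by congr addn; rewrite [RHS]big_mkcond; apply: eq_bigr => i _; rewrite inE.
Qed.

Definition on_left (v : G) := if v.2 is inl _ then true else false.

Lemma cross_adjE (u v : G) :
  adj u v = (u.1 != v.1) && (on_left u != on_left v).
Proof. by case: u v => u [i|i] [v [j|j]]. Qed.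

Lemma card_left : #|[set v : G | on_left v]| = n * x.
Proof.
rewrite card_cross (eq_bigr (fun=> x)) ?sum_nat_const ?card_ord // => u _.
have -> : [set i : 'I_x | (u, inl i) \in [set v : G | on_left v]] = setT.
  by apply/setP => i; rewrite !inE.
have -> : [set i : 'I_y | (u, inr i) \in [set v : G | on_left v]] = set0.
  by apply/setP => i; rewrite !inE.
by rewrite cardsT card_ord cards0 addn0.
Qed.

Lemma card_right : #|[set v : G | ~~ on_left v]| = n * y.
Proof.
rewrite card_cross (eq_bigr (fun=> y)) ?sum_nat_const ?card_ord // => u _.
have -> : [set i : 'I_y | (u, inr i) \in [set v : G | ~~ on_left v]] = setT.
  by apply/setP => i; rewrite !inE.
have -> : [set i : 'I_x | (u, inl i) \in [set v : G | ~~ on_left v]] = set0.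
  by apply/setP => i; rewrite !inE.
by rewrite cardsT card_ord cards0.
Qed.

(** The first [m] fibres carry the mixed classes; fibre [u] gives
    [xs u = (sx + u) %/ m] left vertices, and enough right vertices to reach
    the total [(sx + sy + u) %/ m].  Rounding both quantities with the same shift
    [u] makes the fibre totals near equal and the right parts at most [y]. *)
Lemma mixed_coloring a b m q sx sy :
  m <= n -> sx <= m * x -> sy <= m * y ->
  m * q <= sx + sy <= m * q.+1 ->
  a * q + sx <= n * x <= a * q.+1 + sx ->
  b * q + sy <= n * y <= b * q.+1 + sy ->
  equitably_colorable G (m + (a + b)).
Proof.
move=> mn sxm sym hm ha hb.
pose xs u := (sx + u) %/ m.
pose ys u := (sx + sy + u) %/ m - xs u.
have xsys u : u < m ->
    [/\ xs u <= x, ys u <= y & xs u + ys u = (sx + sy + u) %/ m].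
  move=> um; have m0 : 0 < m by lia.
  have xt : xs u <= (sx + sy + u) %/ m by apply: leq_div2r; lia.
  split; last by rewrite /ys subnKC.
    by rewrite -ltnS ltn_divLR //; nia.
  rewrite leq_subLR -ltnS ltn_divLR //.
  have := ltn_ceil (sx + u) m0; rewrite -/(xs u); nia.
have sumx : \sum_(u < m) xs u = sx.
  by have [m0|m0] := posnP m; [subst m; rewrite big_ord0; lia | apply: sum_divnD].
have sumy : \sum_(u < m) ys u = sy.
  have [m0|m0] := posnP m; first by subst m; rewrite big_ord0; lia.
  have := sum_divnD (sx + sy) m0.
  rewrite (eq_bigr (fun u : 'I_m => xs u + ys u));
    last by move=> u _; case: (xsys u).
  by rewrite big_split /= sumx => /addnI.
pose M : {set G} := [set v : G | (v.1 < m) &&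
  match v.2 with inl i => i < xs v.1 | inr j => j < ys v.1 end].
pose L := [set v : G | on_left v].
pose R := [set v : G | ~~ on_left v].
have sumif (f : nat -> nat) :
    \sum_(u < n) (if u < m then f u else 0) = \sum_(u < m) f u.
  by rewrite -big_mkcond /= (big_ord_widen _ _ mn).
have cardLM : #|L :&: M| = sx.
  rewrite card_cross -sumx -sumif; apply: eq_bigr => u _.
  have -> : [set j | (u, inr j) \in L :&: M] = set0.
    by apply/setP => j; rewrite !inE.
  rewrite cards0 addn0.
  case: ifP => um; last first.
    by apply: eq_card0 => j; rewrite !inE /= um.
  case: (xsys _ um) => xx _ _; rewrite -[RHS](card_ord_ltn xx).
  by apply: eq_card => i; rewrite !inE /= um.
have cardRM : #|R :&: M| = sy.
  rewrite card_cross -sumy -sumif; apply: eq_bigr => u _.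
  have -> : [set i | (u, inl i) \in R :&: M] = set0.
    by apply/setP => i; rewrite !inE.
  rewrite cards0 add0n.
  case: ifP => um; last first.
    by apply: eq_card0 => j; rewrite !inE /= um.
  case: (xsys _ um) => _ yy _; rewrite -[RHS](card_ord_ltn yy).
  by apply: eq_card => i; rewrite !inE /= um.
have splitM : block_colorable M m q.
  exists (fun v : G => v.1 : nat); split.
  - by move=> v; rewrite inE => /andP[].
  - by move=> u v _ _; rewrite cross_adjE => /andP[uv _] /val_inj E;
    rewrite E eqxx in uv.
  move=> u um; have un : u < n by lia.
  have [xx yy xy] := xsys _ um.
  have -> : #|[set v in M | (v.1 : nat) == u]| = xs u + ys u.
    rewrite card_cross (bigD1 (Ordinal un)) //= big1 ?addn0 => [|w wu].
      rewrite -[in RHS](card_ord_ltn xx) -[in RHS](card_ord_ltn yy).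
      by congr addn; apply: eq_card => i; rewrite !inE /= um eqxx andbT.
    have {}wu : (w == u :> nat) = false by apply/negbTE; rewrite -val_eqE in wu.
    by rewrite !eq_card0 // => i; rewrite !inE /= wu andbF.
  have m0 : 0 < m by lia.
  by rewrite xy leq_divRL // -[X in _ && X]ltnS ltn_divLR //; nia.
have splitL : block_colorable (L :\: M) a q.
  apply: block_colorable_independent; last by rewrite cardsD cardLM card_left; lia.
  move=> u v /setDP[+ _] /setDP[+ _]; rewrite !inE cross_adjE => -> ->.
  by rewrite andbF.
have splitR : block_colorable (R :\: M) b q.
  apply: block_colorable_independent; last by rewrite cardsD cardRM card_right; lia.
  move=> u v /setDP[+ _] /setDP[+ _]; rewrite !inE cross_adjE.
  by move=> /negbTE-> /negbTE->; rewrite andbF.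
apply: (@block_colorable_equitable _ _ q).
rewrite (_ : [set: G] = M :|: (L :\: M :|: R :\: M)).
  apply: block_colorableU _ splitM (block_colorableU _ splitL splitR); rewrite -setI_eq0;
    apply/eqP/setP => v; rewrite !(in_setI, in_setU, in_setD) in_set0.
    by case: (v \in M).
  by rewrite !inE; case: on_left; rewrite ?andbF.
apply/setP => v; rewrite !(in_setU, in_setD) in_setT.
by case: (v \in M) => //=; rewrite !inE; case: on_left.
Qed.

(** A left and a right vertex of the same color lie over the same [u], and then
    that fibre contains the whole class. *)
Lemma large_class_unmixed k (c : G -> 'I_k) i :
  proper_coloring c -> x + y < #|color_class c i| ->
  (forall v, c v = i -> on_left v) \/ (forall v, c v = i -> ~~ on_left v).
Proof.
move=> cP big.
have [/existsP[v /andP[/eqP cv lv]]|] := boolP [exists v, (c v == i) && on_left v];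
  last first.
  by move=> /existsPn H; right=> v cv; have := H v; rewrite cv eqxx.
left=> w cw; apply: contraLR big => rw; rewrite -leqNgt.
have same u u' : c u = i -> c u' = i -> on_left u -> ~~ on_left u' -> u.1 = u'.1.
  move=> cu cu' lu lu'; apply/eqP/negP => /negP ne.
  by case: (cP u u'); rewrite ?cu // cross_adjE ne lu (negbTE lu').
have fib u : c u = i -> u.1 = v.1.
  move=> cu; have [lu|lu] := boolP (on_left u); last by rewrite (same v u).
  by rewrite (same v w) // (same u w).
rewrite card_cross (bigD1 v.1) //= big1 ?addn0 => [|u uv].
  by apply: leq_add; apply: leq_trans (max_card _) _; rewrite card_ord.
rewrite !eq_card0 // => j; rewrite !inE; apply/negP=> /eqP/fib /= E;
  by rewrite E eqxx in uv.
Qed.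

(** The bound on [k] says that classes have more than [x + y] vertices even after
    rounding down, so that each lies on one side; [a] and [b] count the classes on
    the left and on the right. *)
Lemma unmixed_counts k :
  equitably_colorable G k -> k * (x + y).+1 < n * (x + y) ->
  exists a b q, [/\ a + b = k, a * q <= n * x <= a * q.+1
    & b * q <= n * y <= b * q.+1].
Proof.
move=> [c [cP ceq]] small.
have cardG : #|G| = n * (x + y) by rewrite card_prod card_sum !card_ord.
have k0 : 0 < k.
  have /card_gt0P[v _] : 0 < #|G| by rewrite cardG; apply: leq_trans small.
  exact: leq_ltn_trans (ltn_ord (c v)).
pose i0 := Ordinal k0.
pose i1 := [arg min_(i < i0) #|color_class c i|].
have [q cq] : exists q, forall i, q <= #|color_class c i| <= q.+1.
  exists #|color_class c i1| => i; have := ceq i i1.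
  rewrite /i1; case: arg_minnP => // j _ /(_ i isT); lia.
have sumq (A : {set 'I_k}) :
    #|A| * q <= \sum_(i in A) #|color_class c i| <= #|A| * q.+1.
  rewrite -!sum_nat_const; apply/andP; split; apply: leq_sum => i _;
  by case/andP: (cq i).
have sumP (P : pred G) :
    \sum_i #|[set v in color_class c i | P v]| = #|[set v | P v]|.
  rewrite -sum1_card (partition_big c predT) //=; apply: eq_bigr => i _.
  by rewrite -sum1_card; apply: eq_bigl => v; rewrite !inE andbC.
have bigq i : x + y < #|color_class c i|.
  have tot : n * (x + y) <= k * q.+1.
    have := sumq setT; rewrite cardsT card_ord -cardG => /andP[_].
    apply: leq_trans; rewrite -cardsT -(sumP predT); apply: eq_leq.
    rewrite [RHS](eq_bigl predT) => [|j]; last by rewrite inE.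
    by apply: eq_bigr => j _; apply: eq_card => v; rewrite !inE andbT.
  by apply: leq_trans (andP (cq i)).1; nia.
pose A := [set i | [forall v, (c v == i) ==> on_left v]].
exists #|A|, #|~: A|, q; split.
- by rewrite cardsC card_ord.
- rewrite -card_left -sumP (_ : \sum_i _ = \sum_(i in A) #|color_class c i|) //.
  rewrite [RHS]big_mkcond; apply: eq_bigr => i _; rewrite inE.
  case: ifP => [/forallP iA|/negP iA].
    apply: eq_card => v; rewrite !inE.
    by case: eqP (implyP (iA v)) => //= _ ->.
  case: (large_class_unmixed cP (bigq i)) => [H|H].
    by case: iA; apply/forallP => v; apply/implyP => /eqP/H.
  by apply: eq_card0 => v; rewrite !inE; apply/negP => /andP[/eqP/H/negbTE->].
rewrite -card_right -sumP (_ : \sum_i _ = \sum_(i in ~: A) #|color_class c i|) //.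
rewrite [RHS]big_mkcond; apply: eq_bigr => i _; rewrite !inE.
case: (large_class_unmixed cP (bigq i)) => [H|H].
  have -> : [forall v, (c v == i) ==> on_left v].
    by apply/forallP => v; apply/implyP => /eqP/H.
  by apply: eq_card0 => v; rewrite !inE; apply/negP => /andP[/eqP/H->].
case: ifP => [_|/negbFE/forallP iA].
  by apply: eq_card => v; rewrite !inE; case: eqP => //= /H ->.
by apply: eq_card0 => v; rewrite !inE; apply/negP => /andP[ci /negP[]];
  apply: (implyP (iA v)).
Qed.
End CrossCompleteBipartite.

(** * Equitable colorings with at least n colors *)

Local Notation graph n :=
  (cross_product (complete_graph n) (complete_bipartite n (n - 1))).

Lemma colorable_few_colors n k : 2 <= n -> n <= k <= 2 * n - 1 ->
  equitably_colorable (graph n) k.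
Proof.
move=> n2 /andP[nk kn].
pose q := (n * (2 * n - 1)) %/ k; pose r := (n * (2 * n - 1)) %% k.
have E : n * (2 * n - 1) = q * k + r by apply: divn_eq.
have rk : r < k by rewrite ltn_mod; lia.
have [t Et] : exists t, k = n + t by exists (k - n); lia.
have tn : t < n by lia.
rewrite Et in E rk *; clearbody q r; clear k Et nk kn.
have [nq hx hy] := pure_classes_fit n2 tn rk E.
have [m Em] : exists m, n = t + m by exists (n - t); lia.
(* The [r] large classes are taken on the left, then mixed, then on the right. *)
have [rx [rm [ry [rE [rxt rmm ryt ryE]]]]] : exists rx rm ry,
    r = rx + rm + ry /\ [/\ rx <= t, rm <= m, ry <= t & ry = r - n].
  exists (minn r t), (minn (r - minn r t) m), (r - n).
  by split; [|split]; lia.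
(* What [t] pure classes leave of each side is reserved for the mixed classes. *)
have [sx Ex] : exists sx, n * n = t * q + rx + sx.
  by exists (n * n - (t * q + rx)); rewrite subnKC // (leq_trans _ hx) // mulnS; lia.
have [sy Ey] : exists sy, n * (n - 1) = t * q + ry + sy.
  by exists (n * (n - 1) - (t * q + ry)); rewrite subnKC // ryE.
have N2 : n * (2 * n - 1) = n * n + n * (n - 1) by rewrite -mulnDr; congr muln; lia.
have tq : t * n <= t * q by rewrite leq_mul2l nq orbT.
have tq1 : t * (n - 1) <= t * q by rewrite leq_mul2l (leq_trans (leq_subr _ _) nq) orbT.
have nn c : n * c = t * c + m * c by rewrite {1}Em mulnDl.
have nk : q * (n + t) = m * q + 2 * (t * q) by rewrite mulnDr (mulnC q n) nn; lia.
have hn := nn n; have hn1 := nn (n - 1).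
have -> : n + t = m + (t + t) by lia.
by apply: (mixed_coloring (q := q) (sx := sx) (sy := sy)); rewrite ?mulnS; lia.
Qed.

Lemma colorable_many_colors n k : 2 <= n -> 2 * n - 1 <= k ->
  equitably_colorable (graph n) k.
Proof.
move=> n2 kn.
pose q := (n * (2 * n - 1)) %/ k; pose r := (n * (2 * n - 1)) %% k.
have E : n * (2 * n - 1) = q * k + r by apply: divn_eq.
have rk : r < k by rewrite ltn_mod; lia.
clearbody q r.
(* [S i] is the size of the first [i] classes, the large ones coming first.  The
   strict lower bound on [n * n] below gives the class [a] at least one left
   vertex, so that its right part has at most [n - 1] vertices. *)
pose S i := i * q + minn i r.
have Sk : S k = n * (2 * n - 1) by rewrite /S; lia.
have [a ha] : exists a, [&& a < k, S a < n * n & n * n <= S a.+1].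
  have ex : exists i, n * n <= S i by exists k; rewrite Sk; nia.
  case: (ex_minnP ex) => -[|a] h1 h2; first by rewrite /S in h1; nia.
  exists a; rewrite h1 andbT; have := h2 a; have := h2 k; rewrite Sk; nia.
case/and3P: ha => ak; rewrite /S => s1 s2.
have -> : k = 1 + (a + (k - a.+1)) by lia.
(* If [q = n] then [k = 2 * n - 1] and no class is large. *)
have qn : q + (minn a.+1 r - minn a r) <= n.
  have kn' : n * (2 * n - 1) <= n * k by rewrite leq_mul2l kn orbT.
  have : q <= n.
    rewrite -(leq_pmul2r (_ : 0 < k)); first by lia.
    by lia.
  rewrite leq_eqVlt => /orP[/eqP qn|]; last by lia.
  by rewrite qn in E *; lia.
have [b Eb] : exists b, k = a.+1 + b by exists (k - a.+1); lia.
have N2 : n * (2 * n - 1) = n * n + n * (n - 1) by rewrite -mulnDr; congr muln; lia.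
have kq : q * k = a * q + q + b * q by rewrite Eb mulnC mulnDl mulSn; lia.
have -> : a + (k - a.+1) = a + b by lia.
apply: (mixed_coloring (q := q) (sx := n * n - (a * q + minn a r))
  (sy := a.+1 * q + minn a.+1 r - n * n)); rewrite ?mulnS ?mulSn ?mul0n in s2 *; lia.
Qed.

(** * Fewer than n colors *)

Lemma colorable_lower_bound n k : 2 <= n -> equitably_colorable (graph n) k -> n <= k.
Proof.
move=> n2 col; rewrite leqNgt; apply/negP => kn.
have [|a [b [q [ab ha hb]]]] := unmixed_counts col; first by nia.
by apply: no_unmixed_split ha hb; rewrite ?ab.
Qed.

(** * The equitable chromatic number and threshold *)

Theorem theorem12 (n : nat) (hn : 2 <= n) :
  equitable_chromatic_number
    (cross_product (complete_graph n) (complete_bipartite n (n - 1))) n /\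
  equitable_chromatic_threshold
    (cross_product (complete_graph n) (complete_bipartite n (n - 1))) n.
Proof.
have all_k k : n <= k -> equitably_colorable (graph n) k.
  move=> nk; have [kn|/ltnW kn] := leqP k (2 * n - 1);
    last exact: colorable_many_colors.
  by apply: colorable_few_colors; rewrite ?nk.
have low k : equitably_colorable (graph n) k -> n <= k by apply: colorable_lower_bound.
by split; split=> [|k col];
  [exact: all_k | exact: low | exact: all_k | exact/low/col].
Qed.
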